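(* For a given stable matching instance with one-sided uncertainty, there is a $1$-competitive algorithm for finding a stable matching in the comparison query model. Moreover, the stable matching found by this algorithm is the $A$-optimal stable matching.
   Context: Two disjoint sets $A$, $B$ of agents with $|A|=|B|=n$. Each $a\in A$ has a strict total order $\prec_a$ on $B$ and each $b\in B$ has a strict total order $\prec_b$ on $A$; $x\prec_y z$ means that $y$ prefers $x$ to $z$. A matching is a bijection between $A$ and $B$. A pair $(a,b)$ with $b\neq M(a)$ is blocking if $a$ prefers $b$ to $M(a)$ and $b$ prefers $a$ to $M(b)$; $M$ is stable if it has no blocking pair. A stable matching is $A$-optimal if every agent of $A$ weakly prefers its partner in it to its partner in any other stable matching. One-sided uncertainty: the orders $\prec_a$ ($a\in A$) are known initially, the orders $\prec_b$ ($b\in B$) are unknown and are learned only via queries. A comparison query $\mathit{prefer}(b,a_1,a_2)$ returns whichever of $a_1,a_2$ agent $b$ prefers. An algorithm adaptively makes queries until the known information proves its output correct (correct for every $B$-side preference profile consistent with the $A$-side preferences and the answers). It is $\rho$-competitive if on every instance its number of queries is at most $\rho$ times the minimum size of a query set whose answers on that instance suffice to prove some correct output (possibly a different stable matching). *)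

(* Defs.v *)
From HB Require Import structures.
From mathcomp Require Import all_boot all_order all_algebra.

Set Implicit Arguments.
Unset Strict Implicit.
Unset Printing Implicit Defensive.

Import Order.TTheory GRing.Theory Num.Theory.
Local Open Scope ring_scope.

(* [sto x y] means that [x] is preferred to [y]. *)
Record strict_total_order (T : finType) := StrictTotalOrder {
  sto :> rel T;
  sto_irr : irreflexive sto;
  sto_trans : transitive sto;
  sto_total : forall x y, x != y -> sto x y || sto y x
}.

Section StableMatching.
Variables A B : finType.

Definition profileA := A -> strict_total_order B.
Definition profileB := B -> strict_total_order A.

Record matching := Matching {
  mateA : {ffun A -> B};
  mateB : {ffun B -> A};
  mateAK : cancel mateA mateB;
  mateBK : cancel mateB mateA
}.

Definition blocking (PA : profileA) (PB : profileB) (M : matching)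
    (a : A) (b : B) : bool :=
  [&& b != mateA M a, PA a b (mateA M a) & PB b a (mateB M b)].

Definition stable (PA : profileA) (PB : profileB) (M : matching) : Prop :=
  forall a b, ~~ blocking PA PB M a b.

Definition A_optimal (PA : profileA) (PB : profileB) (M : matching) : Prop :=
  stable PA PB M /\
  forall M', stable PA PB M' ->
    forall a, mateA M a = mateA M' a \/ PA a (mateA M a) (mateA M' a).

(* [(b, a1, a2)] asks [b] to compare [a1] and [a2]. The degenerate query with
   [a1 = a2] is allowed: it has a constant answer, so it reveals nothing. *)
Definition query : Type := (B * A * A)%type.

Definition prefer (PB : profileB) (q : query) : A :=
  let: (b, a1, a2) := q in if PB b a1 a2 then a1 else a2.

Definition consistent (PB PB' : profileB) (Q : {set query}) : Prop :=
  forall q, q \in Q -> prefer PB' q = prefer PB q.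

(* [PB] is the true profile; it matters only through its answers on [Q]. *)
Definition proves_stable (PA : profileA) (PB : profileB) (Q : {set query})
    (M : matching) : Prop :=
  forall PB', consistent PB PB' Q -> stable PA PB' M.

Definition is_opt_cost (PA : profileA) (PB : profileB) (k : nat) : Prop :=
  (exists (Q : {set query}) (M : matching),
     proves_stable PA PB Q M /\ #|Q| = k) /\
  (forall (Q : {set query}) (M : matching),
     proves_stable PA PB Q M -> (k <= #|Q|)%N).

(* An adaptive, terminating strategy: [next] receives the answer to the query,
   so what is asked or output depends on the B-side profile only through the
   answers received so far. *)
Inductive strategy :=
  | Output of matching
  | Ask (q : query) (next : A -> strategy).

Fixpoint output (S : strategy) (PB : profileB) : matching :=
  match S with
  | Output M => M
  | Ask q next => output (next (prefer PB q)) PB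
  end.

(* With repetitions, so that repeated queries are charged every time. *)
Fixpoint queries (S : strategy) (PB : profileB) : seq query :=
  match S with
  | Output _ => [::]
  | Ask q next => q :: queries (next (prefer PB q)) PB
  end.

End StableMatching.

(* The B-side profile is not an argument. *)
Definition algorithm := forall (n : nat) (A B : finType),
  #|A| = n -> #|B| = n -> profileA A B -> strategy A B.

Definition solves_stable_matching (alg : algorithm) : Prop :=
  forall (n : nat) (A B : finType) (hA : #|A| = n) (hB : #|B| = n)
         (PA : profileA A B) (PB : profileB A B),
    let S := alg n A B hA hB PA in
    proves_stable PA PB [set q in queries S PB] (output S PB).

Definition competitive (rho : rat) (alg : algorithm) : Prop :=
  forall (n : nat) (A B : finType) (hA : #|A| = n) (hB : #|B| = n)
         (PA : profileA A B) (PB : profileB A B),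
    exists2 k : nat, is_opt_cost PA PB k &
      (size (queries (alg n A B hA hB PA) PB))%:R <= rho * k%:R.

Definition finds_A_optimal (alg : algorithm) : Prop :=
  forall (n : nat) (A B : finType) (hA : #|A| = n) (hB : #|B| = n)
         (PA : profileA A B) (PB : profileB A B),
    A_optimal PA PB (output (alg n A B hA hB PA) PB).

(* Main.v *)
Require Import Defs.
From mathcomp Require Import all_boot all_order all_algebra.

(**
The algorithm is deferred acceptance with [A] proposing, with the set [R] of
rejected pairs as its only state: while two agents of [A] share the same
favourite non-rejected partner [b], ask [b] to compare them and reject the
loser. Each query enlarges [R] by one pair, and every rejected pair [(a, b)]
satisfies [b <_a M' a] for every stable matching [M']. Conversely, a query set
proving [M'] stable must contain, for each pair [(a, b)] with [b <_a M' a], a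
query to [b] lost by [a]: otherwise raising [a] to the top of [b]'s list is
consistent with all answers and makes [(a, b)] blocking. A query has only one
loser, so these queries are distinct, and no query set proving the stability
of some matching has fewer than [#|R|] queries.
*)

Set Implicit Arguments.
Unset Strict Implicit.
Unset Printing Implicit Defensive.

Import GRing.Theory.
Local Open Scope ring_scope.

(** * Best elements, and raising an element to the top *)

Section StrictTotalOrder.
Variable T : finType.
Implicit Types (r : strict_total_order T) (S : {set T}).

Lemma sto_asym r x y : r x y -> ~~ r y x.
Proof.
by move=> rxy; apply/negP => /(sto_trans rxy); rewrite sto_irr.
Qed.

Definition is_best r S x :=
  (x \in S) && [forall y in S, (y != x) ==> r x y].

Lemma is_bestP r S x :
  reflect (x \in S /\ forall y, y \in S -> y != x -> r x y) (is_best r S x).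
Proof.
apply: (iffP andP) => -[xS best]; split=> //.
  by move=> y yS; apply/implyP; move/forall_inP: best; apply.
by apply/forall_inP => y yS; apply/implyP; apply: best.
Qed.

Lemma ex_best r S : S != set0 -> exists x, is_best r S x.
Proof.
case/set0Pn=> x0 x0S.
(* Minimise the number of elements of [S] preferred to [x]: if some [y] beat [x], transitivity would
   make the count of [y] strictly smaller. *)
case: (arg_minnP (fun x => #|[set y in S | r y x]|) x0S) => x xS min_x.
exists x; apply/is_bestP; split=> // y yS ny.
have /orP[//|ryx] := sto_total r (x := x) (y := y) (contra_neq esym ny).
have := min_x y yS; rewrite leqNgt => /negP[]; apply/proper_card/properP.
split; first by apply/subsetP => z; rewrite !inE => /andP[-> /sto_trans]; apply.
by exists y; rewrite inE yS ?ryx // sto_irr.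
Qed.

Definition raise_rel (a : T) r : rel T :=
  fun x y => (y != a) && ((x == a) || r x y).

Lemma raise_irr a r : irreflexive (raise_rel a r).
Proof. by move=> x; rewrite /raise_rel sto_irr orbF andNb. Qed.

Lemma raise_trans a r : transitive (raise_rel a r).
Proof.
move=> y x z /andP[/negPf ya rxy] /andP[za]; rewrite ya /= => ryz.
rewrite /raise_rel za; case/orP: rxy => [-> //|rxy].
by rewrite (sto_trans rxy ryz) orbT.
Qed.

Lemma raise_total a r x y : x != y -> raise_rel a r x y || raise_rel a r y x.
Proof.
rewrite /raise_rel => nxy; have rxy := sto_total r nxy.
case: (eqVneq x a) nxy rxy => [->|_] /=; first by rewrite eq_sym => ->.
by case: (y == a).
Qed.

Definition raise a r :=
  StrictTotalOrder (@raise_irr a r) (@raise_trans a r) (@raise_total a r).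

End StrictTotalOrder.

(** * Consistent profiles and the lower bound on proving query sets *)

Section DeferredAcceptance.
Variables (A B : finType) (cardAB : #|A| = #|B|) (PA : profileA A B).
Implicit Types (R : {set A * B}) (PB : profileB A B) (M : matching A B).
Implicit Types (Q : {set query A B}).

(** Equal answers lead down the same branch. Hence an output that is stable for every profile it is
    computed on is also proved stable by its queries. *)
Lemma output_consistent (S : strategy A B) PB PB' :
  consistent PB PB' [set q in queries S PB] -> output S PB' = output S PB.
Proof.
elim: S => //= q next IH cons.
have -> : prefer PB' q = prefer PB q by apply: cons; rewrite inE mem_head.
by apply: IH => p; rewrite inE => pS; apply: cons; rewrite !inE pS orbT.
Qed.

Definition loser PB (q : query A B) : A :=
  let: (b, a1, a2) := q in if PB b a1 a2 then a2 else a1.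

Definition raise_at (a : A) (b : B) PB : profileB A B :=
  fun b' => if b' == b then raise a (PB b') else PB b'.

(** Raising [a] only alters comparisons that [a] loses. Queries with [a1 = a2] are exempt, their
    answer being constant. *)
Lemma raise_at_consistent PB Q a b :
  (forall a1 a2, (b, a1, a2) \in Q -> a1 != a2 -> loser PB (b, a1, a2) != a) ->
  consistent PB (raise_at a b PB) Q.
Proof.
move=> noloss [[b' a1] a2] qQ; rewrite /= /raise_at.
case: (eqVneq b' b) qQ => [->|//] qQ /=; rewrite /raise_rel.
case: (eqVneq a1 a2) qQ => [->|n12] qQ; first by rewrite !if_same.
have := noloss _ _ qQ n12; rewrite /=.
by case: ifP => /= [_ ->|_ /negPf->]; rewrite ?orbT ?andbF.
Qed.

Lemma loss_of_proves_stable PB Q M a b :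
  proves_stable PA PB Q M -> PA a b (mateA M a) ->
  exists a1 a2, (b, a1, a2) \in Q /\ loser PB (b, a1, a2) = a.
Proof.
move=> MQ ab.
have [/existsP[a1 /existsP[a2 /andP[qQ /eqP la]]]|none] :=
  boolP [exists a1, exists a2, ((b, a1, a2) \in Q) && (loser PB (b, a1, a2) == a)].
  by exists a1, a2.
have nab : b != mateA M a by apply/eqP => e; move: ab; rewrite -e sto_irr.
have cons : consistent PB (raise_at a b PB) Q.
  apply: raise_at_consistent => a1 a2 qQ _; apply/negP => la.
  case/negP: none; apply/existsP; exists a1; apply/existsP; exists a2.
  by rewrite qQ.
case/negP: (MQ _ cons a b); rewrite /blocking nab ab /raise_at eqxx /=.
rewrite /raise_rel eqxx andbT; apply: contra nab => /eqP <-.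
by rewrite mateBK.
Qed.

Lemma card_proves_stable PB Q M :
  proves_stable PA PB Q M -> (#|[set p | PA p.1 p.2 (mateA M p.1)]| <= #|Q|)%N.
Proof.
move=> MQ; apply: leq_trans (leq_imset_card (fun q => (loser PB q, q.1.1)) Q).
apply/subset_leq_card/subsetP => -[a b]; rewrite inE /= => ab.
have [a1 [a2 [qQ la]]] := loss_of_proves_stable MQ ab.
by apply/imsetP; exists (b, a1, a2); rewrite ?la.
Qed.

(** * Matchings from injections *)

Lemma matching_of_inj_proof (f : A -> B) : injective f -> forall b, b \in codom f.
Proof. by move=> inj_f b; apply: inj_card_onto; rewrite // cardAB. Qed.

Lemma matching_of_injAK (f : A -> B) (inj_f : injective f) :
  cancel [ffun a => f a] [ffun b => iinv (matching_of_inj_proof inj_f b)].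
Proof. by move=> a; apply: (inj_f); rewrite !ffunE f_iinv. Qed.

Lemma matching_of_injBK (f : A -> B) (inj_f : injective f) :
  cancel [ffun b => iinv (matching_of_inj_proof inj_f b)] [ffun a => f a].
Proof. by move=> b; rewrite !ffunE f_iinv. Qed.

Definition matching_of_inj (f : A -> B) (inj_f : injective f) :=
  Matching (matching_of_injAK inj_f) (matching_of_injBK inj_f).

Definition any_bijection (a : A) : B := enum_val (cast_ord cardAB (enum_rank a)).

Lemma any_bijection_inj : injective any_bijection.
Proof. by move=> a a' /enum_val_inj/cast_ord_inj/enum_rank_inj. Qed.

(** The default keeps this total: favourites form an injection only once conflicts are gone. *)
Definition matching_of (f : A -> B) : matching A B :=
  if injectiveP f is ReflectT inj_f then matching_of_inj inj_f
  else matching_of_inj any_bijection_inj.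

Lemma mateA_matching_of (f : A -> B) :
  injective f -> mateA (matching_of f) =1 f.
Proof.
move=> inj_f a; rewrite /matching_of; case: injectiveP => [inj_f'|//].
by rewrite ffunE.
Qed.

(** * Rejected pairs and their invariant *)

Definition top R (a : A) : option B :=
  [pick b | is_best (PA a) [set c | (a, c) \notin R] b].

Lemma topP R a b : top R a = Some b ->
  (a, b) \notin R /\ forall c, (a, c) \notin R -> c != b -> PA a b c.
Proof.
rewrite /top; case: pickP => // x /is_bestP[]; rewrite inE => xR best [<-].
by split=> // c cR; apply: best; rewrite inE.
Qed.

Lemma top_None R a b : top R a = None -> (a, b) \in R.
Proof.
rewrite /top; case: pickP => // nobest _; apply/negPn/negP => bR.
have [|x] := @ex_best _ (PA a) [set c | (a, c) \notin R].
  by apply/set0Pn; exists b; rewrite inE.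
by rewrite nobest.
Qed.

Lemma top_reject R l b a : a != l -> top ((l, b) |: R) a = top R a.
Proof.
move=> nal; rewrite /top.
have -> // : [set c | (a, c) \notin (l, b) |: R] = [set c | (a, c) \notin R].
by apply/setP => d; rewrite !inE xpair_eqE (negPf nal).
Qed.

(** The first half, that whoever rejects holds a proposer it prefers, gives stability and ensures
    that nobody runs out of partners. The second half gives [A]-optimality and the comparison with
    any proving query set. *)
Definition invariant PB R : Prop :=
  (forall a b, (a, b) \in R -> exists2 a', top R a' = Some b & PB b a' a) /\
  (forall M a b, stable PA PB M -> (a, b) \in R -> PA a b (mateA M a)).

Lemma invariant0 PB : invariant PB set0.
Proof. by split=> [a b|M a b _]; rewrite inE. Qed.

Lemma invariant_reject PB R w l b : top R w = Some b -> top R l = Some b ->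
  PB b w l -> invariant PB R -> invariant PB ((l, b) |: R).
Proof.
move=> tw tl wl [held below].
have nwl : w != l by apply: contraTneq wl => ->; rewrite sto_irr.
have tw' : top ((l, b) |: R) w = Some b by rewrite top_reject.
split=> [a c|M a c stM].
  rewrite in_setU1 => /predU1P[[-> ->]|/held[a' ta' ra']]; first by exists w.
  (* Only [b] was held by [l]; there [w] takes over, by transitivity. *)
  have [ea|na] := eqVneq a' l; last by exists a'; rewrite ?top_reject.
  move: ta' ra'; rewrite ea tl => -[<-] la; exists w => //.
  exact: sto_trans wl la.
have notR a0 : (a0, mateA M a0) \notin R.
  by apply/negP => /(below _ _ _ stM); rewrite sto_irr.
rewrite in_setU1 => /predU1P[[-> ->]|]; last exact: below.
(* If [M] matched [l] with [b], then [w], whose partner in [M] is not rejected and so is worse than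
   its favourite [b], would block [M] together with [b]. *)
apply: (topP tl).2 => //; apply/eqP => Ml; have Mb : mateB M b = l.
  by rewrite -Ml mateAK.
have nMw : mateA M w != b.
  by apply: contra nwl => /eqP Mw; rewrite -Mb -Mw mateAK.
case/negP: (stM w b); rewrite /blocking eq_sym nMw Mb wl andbT /=.
exact: (topP tw).2.
Qed.

(** Pigeonhole: had all of [B] rejected [a], each of them would be the favourite of some agent other
    than [a], but only [#|A|.-1] such agents exist. *)
Lemma top_total PB R a : invariant PB R -> exists b, top R a = Some b.
Proof.
case=> held _; case ta: (top R a) => [b|]; first by exists b.
have sub : [set Some b | b in [set: B]] \subset [set top R x | x in [set~ a]].
  apply/subsetP => _ /imsetP[b _ ->].
  have [a' ta' _] := held a b (top_None b ta).
  apply/imsetP; exists a' => //; rewrite !inE.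
  by apply: contra_eq_neq ta' => ->; rewrite ta.
have := leq_trans (subset_leq_card sub) (leq_imset_card _ _).
rewrite card_imset; last exact: Some_inj.
rewrite cardsT -cardAB cardsC1 => leA; suff : (#|A|.-1 < #|A|)%N.
  by rewrite ltnNge leA.
by rewrite prednK //; apply/card_gt0P; exists a.
Qed.

(** * The strategy and its run *)

Definition conflict R (q : query A B) :=
  let: (b, a1, a2) := q in
  [&& a1 != a2, top R a1 == Some b & top R a2 == Some b].

Definition current_matching R : matching A B :=
  matching_of (fun a => odflt (any_bijection a) (top R a)).

Fixpoint run (fuel : nat) R : strategy A B :=
  match fuel, [pick q | conflict R q] with
  | fuel'.+1, Some (b, a1, a2) =>
      Ask (b, a1, a2)
        (fun w => run fuel' ((if w == a1 then a2 else a1, b) |: R))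
  | _, _ => Output (current_matching R)
  end.

Lemma top_current_matching PB R a : invariant PB R -> (forall q, ~~ conflict R q) ->
  top R a = Some (mateA (current_matching R) a).
Proof.
move=> invR free; have [b ta] := top_total a invR.
rewrite mateA_matching_of ?ta // => a1 a2.
have [[b1 t1] [b2 t2]] := (top_total a1 invR, top_total a2 invR).
rewrite t1 t2 /= => e; apply/eqP.
by have := free (b2, a1, a2); rewrite /= t1 t2 e eqxx !andbT negbK.
Qed.

(** Each query adds a new pair to [R], so [#|R| + fuel] is constant. The strict bound excludes
    [fuel = 0], hence the run stops only when no conflict is left. *)
Lemma run_spec PB fuel R : invariant PB R -> (#|{: A * B}| < #|R| + fuel)%N ->
  exists R', [/\ invariant PB R', forall q, ~~ conflict R' q,
    output (run fuel R) PB = current_matching R' &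
    (size (queries (run fuel R) PB) + #|R| = #|R'|)%N].
Proof.
elim: fuel R => [|fuel IH] R invR; first by rewrite addn0 ltnNge max_card.
move=> bound /=; case: pickP => [[[b a1] a2]|free]; last first.
  by exists R; split=> // q; rewrite free.
case/and3P => n12 /eqP t1 /eqP t2 /=.
set l := if _ == a1 then a2 else a1.
have [w tw [tl wl]] : exists2 w, top R w = Some b & top R l = Some b /\ PB b w l.
  rewrite /l; have := sto_total (PB b) n12.
  case: (boolP (PB b a1 a2)) => [r12 _|_ /= r21]; first by rewrite eqxx; exists a1.
  by rewrite eq_sym (negPf n12); exists a2.
have cardR : #|(l, b) |: R| = #|R|.+1 by rewrite cardsU1 (topP tl).1.
have [||R' [invR' free -> sz]] := IH ((l, b) |: R).
- exact: invariant_reject wl invR.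
- by rewrite cardR addSnnS.
by exists R'; split=> //; rewrite -sz cardR addSnnS.
Qed.

Definition deferred_acceptance : strategy A B := run #|{: A * B}|.+1 set0.

Lemma deferred_acceptanceP PB : exists R,
  [/\ invariant PB R,
      forall a, top R a = Some (mateA (output deferred_acceptance PB) a) &
      size (queries deferred_acceptance PB) = #|R|].
Proof.
have [|R [invR free out sz]] := run_spec (fuel := #|{: A * B}|.+1) (invariant0 PB).
  by rewrite cards0.
exists R; rewrite -sz cards0 addn0 /deferred_acceptance out; split=> // a.
exact: top_current_matching invR free.
Qed.

(** * Stability, optimality and query count *)

Lemma deferred_acceptance_stable PB : stable PA PB (output deferred_acceptance PB).
Proof.
have [R [[held _] topR _]] := deferred_acceptanceP PB.
set M := output _ _ in topR *; move=> a b; apply/negP => /and3P[nab ab ba].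
(* If [b] has not rejected [a], then [a] likes its partner at least as much as [b]; otherwise the
   partner of [b] is the proposer it holds, whom it prefers to [a]. *)
have [abR|abR] := boolP ((a, b) \in R); last first.
  by case/negP: (sto_asym ab); apply: (topP (topR a)).2.
have [a'] := held _ _ abR; rewrite topR => -[Ma'] /sto_asym/negP[].
by rewrite -[a'](mateAK M) Ma'.
Qed.

Lemma deferred_acceptance_proves_stable PB :
  proves_stable PA PB [set q in queries deferred_acceptance PB]
    (output deferred_acceptance PB).
Proof.
move=> PB' /output_consistent <-; exact: deferred_acceptance_stable.
Qed.

Lemma deferred_acceptance_A_optimal PB :
  A_optimal PA PB (output deferred_acceptance PB).
Proof.
split=> [|M stM a]; first exact: deferred_acceptance_stable.
have [R [[_ below] topR _]] := deferred_acceptanceP PB.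
have [->|nM] := eqVneq (mateA M a) (mateA (output deferred_acceptance PB) a).
  by left.
right; apply: (topP (topR a)).2 => //.
by apply/negP => /(below _ _ _ stM); rewrite sto_irr.
Qed.

Lemma size_deferred_acceptance PB Q M : proves_stable PA PB Q M ->
  (size (queries deferred_acceptance PB) <= #|Q|)%N.
Proof.
move=> MQ; have [R [[_ below] _ ->]] := deferred_acceptanceP PB.
(* [M] is stable under [PB] itself, so the second half of the invariant puts [R] inside the set of
   pairs counted there. *)
apply: leq_trans (card_proves_stable MQ); apply/subset_leq_card/subsetP.
move=> [a b] abR; rewrite inE /=; apply: below => //.
exact: MQ.
Qed.

Lemma deferred_acceptance_opt_cost PB :
  is_opt_cost PA PB (size (queries deferred_acceptance PB)).
Proof.
split=> [|Q M]; last exact: size_deferred_acceptance.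
have MQ := @deferred_acceptance_proves_stable PB.
do 2!eexists; split; first exact: MQ.
(* Applied to the algorithm's own query set, the lower bound shows that no query is repeated. *)
apply/eqP; rewrite eqn_leq (size_deferred_acceptance MQ) andbT.
by rewrite cardsE card_size.
Qed.

End DeferredAcceptance.

Theorem theorem6 :
  exists alg : algorithm,
    [/\ solves_stable_matching alg, competitive 1 alg & finds_A_optimal alg].
Proof.
exists (fun n A B hA hB PA => deferred_acceptance (etrans hA (esym hB)) PA).
split=> n A B hA hB PA PB.
- exact: deferred_acceptance_proves_stable.
- exists (size (queries (deferred_acceptance (etrans hA (esym hB)) PA) PB)).
    exact: deferred_acceptance_opt_cost.
  by rewrite mul1r.
- exact: deferred_acceptance_A_optimal.
Qed.
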